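(* Let $\mathbb{T}\subset\mathbb{R}$ be a time scale, let $f:\mathbb{T}\to\mathbb{C}$ be delta (Hilger) differentiable at every point $t\in\mathbb{T}^\kappa$, and suppose that its extension $\bar f:\mathbb{R}\to\mathbb{C}$ is locally of bounded variation. Then the Radon--Nikodym derivative of $\bar f$ with respect to $\sigma$ and the Hilger derivative of $f$ coincide at every point of $\mathbb{T}^\kappa$; that is, for every $t\in\mathbb{T}^\kappa$ the limit defining $\frac{d\bar f}{d\sigma}(t)$ exists and $$\frac{d\bar f}{d\sigma}(t)=f^\Delta(t).$$
   Context: A time scale $\mathbb{T}$ is a nonempty closed subset of $\mathbb{R}$. The forward shift $\sigma:\mathbb{R}\to\mathbb{R}$ is defined by $\sigma(t)=\inf\{s\in\mathbb{T}: t<s\}$ if $t<\sup\mathbb{T}$ and $\sigma(t)=\sup\mathbb{T}$ if $t\ge\sup\mathbb{T}$. It is nondecreasing and right continuous. Put $\mathbb{T}^\kappa=\overline{\mathbb{T}\setminus\{\sup\mathbb{T}\}}$ (so $\mathbb{T}^\kappa=\mathbb{T}$ unless $\mathbb{T}$ has a left scattered maximum, in which case that maximum is removed). For a function $g:\mathbb{R}\to\mathbb{C}$ locally of bounded variation write $g_\pm(t)=\lim_{\varepsilon\downarrow0}g(t\pm\varepsilon)$. The same letter $\sigma$ denotes the Borel measure on $\mathbb{R}$ with distribution function $\sigma$, i.e. $\sigma((a,b])=\sigma_+(b)-\sigma_+(a)$, $\sigma([a,b])=\sigma_+(b)-\sigma_-(a)$, $\sigma((a,b))=\sigma_-(b)-\sigma_+(a)$,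 $\sigma([a,b))=\sigma_-(b)-\sigma_-(a)$. In the same way every $\nu:\mathbb{R}\to\mathbb{C}$ locally of bounded variation has an associated measure, denoted by the same letter $\nu$. The pointwise value of the Radon--Nikodym derivative of $\nu$ with respect to $\sigma$ at $t$ is given by the limit $$\frac{d\nu}{d\sigma}(t)=\lim_{\varepsilon\downarrow0}\frac{\nu((t-\varepsilon,t+\varepsilon))}{\sigma((t-\varepsilon,t+\varepsilon))}=\lim_{\varepsilon\downarrow0}\frac{\nu_-(t+\varepsilon)-\nu_+(t-\varepsilon)}{\sigma_-(t+\varepsilon)-\sigma_+(t-\varepsilon)},$$ whenever this limit exists. A function $f:\mathbb{T}\to\mathbb{C}$ is delta (or Hilger) differentiable at $t\in\mathbb{T}$ if there is a number $f^\Delta(t)$ such that for every $\varepsilon>0$ there is a neighborhood $U\subset\mathbb{T}$ of $t$ (relative to $\mathbb{T}$) with $|f(\sigma(t))-f(s)-f^\Delta(t)(\sigma(t)-s)|\le\varepsilon|\sigma(t)-s|$ for all $s\in U$. The extension $\bar f:\mathbb{R}\to\mathbb{C}$ of $f:\mathbb{T}\to\mathbb{C}$ is defined by $\bar f(t)=f(t)$ for $t\in\mathbb{T}$ and $\bar f(t)=f(\sigma(t))$ for $t\notin\mathbb{T}$. *)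

(* Defs.v *)
From HB Require Import structures.
From mathcomp Require Import all_boot all_order all_algebra.
From mathcomp Require Import all_classical all_reals all_analysis.
From mathcomp Require Import complex.

Set Implicit Arguments.
Unset Strict Implicit.
Unset Printing Implicit Defensive.
Import Order.TTheory GRing.Theory Num.Theory.
Import numFieldNormedType.Exports.
Local Open Scope classical_set_scope.
Local Open Scope ring_scope.
Local Open Scope complex_scope.

(* The complex numbers are R[i]^o: the alias ^o carries the normed topology
   coming from the field structure of R[i].  Norms of complex numbers live in
   R[i], so real bounds are injected with %:C. *)

Section OneSidedLimits.
Context {R : realType} {K : numFieldType} {V : normedModType K}.
Implicit Types (g : R -> V) (a b t : R).

Definition right_lim g t : V := lim (g x @[x --> t^'+]).
Definition left_lim g t : V := lim (g x @[x --> t^'-]).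

(* The value on the open interval ]a, b[ (a < b) of the Borel measure
   with distribution function g. *)
Definition stieltjes_oo g a b : V := left_lim g b - right_lim g a.

End OneSidedLimits.

Section TimeScales.
Context {R : realType}.
Local Notation C := (R[i]^o).
Implicit Types (T : set R) (t : R).

Definition time_scale T := T !=set0 /\ closed T.

Definition ts_sup T : \bar R := ereal_sup [set t%:E | t in T].

(* [fine] only meets a finite value when T is a time scale: there
   ts_sup T <= t%:E and T is nonempty. *)
Definition sigma T t : R :=
  if (t%:E < ts_sup T)%E then inf [set s | T s /\ t < s] else fine (ts_sup T).

Definition ts_kappa T : set R := closure [set t | T t /\ t%:E <> ts_sup T].

(* Functions on T are represented by total functions on R, of which
   only the values on T are used: if T is a time scale, sigma T takes its
   values in T. *)
Definition is_delta_derivative T (f : R -> C) t (d : C) :=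
  forall e : R, 0 < e ->
    \forall s \near within T (nbhs t),
      `| f (sigma T t) - f s - d * (sigma T t - s)%:C |
        <= (e * `| sigma T t - s |)%:C.

Definition ts_extension T (f : R -> C) : R -> C :=
  fun t => if t \in T then f t else f (sigma T t).

(* [variation] and [bounded_variation] of the library are restricted to
   real-valued functions. *)
Definition complex_variation a b (g : R -> C) (s : seq R) : C :=
  let G := g \o nth b (a :: s) in \sum_(0 <= n < size s) `| G n.+1 - G n |.

Definition locally_bounded_variation (g : R -> C) :=
  forall a b : R, a <= b ->
    exists M : R, forall s, itv_partition a b s ->
      complex_variation a b g s <= M%:C.

(* The pointwise Radon-Nikodym derivative of (the measure of) nu with respect
   to (the measure of) mu at t exists and equals l.  The first conjunct makes
   the quotient meaningful, as x / 0 = 0 in MathComp. *)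
Definition is_RN_derivative (nu : R -> C) (mu : R -> R) t (l : C) :=
  (\forall e \near (0 : R)^'+, stieltjes_oo mu (t - e) (t + e) != 0) /\
  (stieltjes_oo nu (t - e) (t + e) / (stieltjes_oo mu (t - e) (t + e))%:C
     @[e --> (0 : R)^'+] --> l).

End TimeScales.

(* Main.v *)
Require Import Defs.
From HB Require Import structures.
From mathcomp Require Import all_boot all_order all_algebra.
From mathcomp Require Import all_classical all_reals all_analysis.
From mathcomp Require Import complex.
From mathcomp Require Import ring lra.

Set Implicit Arguments.
Unset Strict Implicit.
Unset Printing Implicit Defensive.
Import Order.TTheory GRing.Theory Num.Theory.
Import numFieldNormedType.Exports.
Local Open Scope classical_set_scope.
Local Open Scope ring_scope.
Local Open Scope complex_scope.

(** Let tau u be the first point of T at or after u, and sup T when there is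
    none.  The extension of f is f \o tau, and tau is squeezed by sigma:
    sigma u <= tau v for u < v, while tau v <= sigma v.  Hence tau and sigma
    have the same one-sided limits everywhere, so the measure of an open
    interval for sigma can be computed from increments of tau.

    Fix t in T^kappa with Hilger derivative d, and eta > 0.  If u is close to
    t, then tau u is either close to t or equal to sigma t: on the left of t,
    tau u lies in [u, t]; on the right, tau u tends to sigma t by right
    continuity of sigma, and equals sigma t near t when t is right scattered.
    As the Hilger inequality at s = sigma t reads 0 <= 0, it holds at
    s = tau u for every such u.  For u < t < v near t the inequality at
    tau v, subtracted from the one at tau u, gives, because
    tau u <= sigma t <= tau v,
      |f (tau v) - f (tau u) - d (tau v - tau u)| <= eta (tau v - tau u)
    (extension_increment_bound).  The right-hand side is an increment of tau
    with no absolute value, so the bound passes to the limits v -> t + e from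
    the left and u -> t - e from the right, which exist since a function of
    bounded variation has one-sided limits.  There the bound compares the two
    measures of ]t - e, t + e[, and dividing by the one for sigma, which is
    positive because t lies in T^kappa (sigma_oo_gt0), shows that the quotient
    is within eta of d. *)

(** * Limits of complex-valued functions *)

Section ComplexLimits.
Context {R : realType}.
Local Notation C := (R[i]^o).

Lemma norm_real_complex (x : R) : `|x%:C : C| = `|x|%:C.
Proof. by rewrite normc_def /= expr0n addr0 sqrtr_sqr. Qed.

Lemma gt0_real_complex (e : C) : 0 < e -> exists2 r : R, 0 < r & e = r%:C.
Proof.
case: e => r s; rewrite ltcE /= => /andP[/eqP -> r0]; by exists r.
Qed.

Section Filter.
Context {T : Type} {F : set_system T} {FF : ProperFilter F}.

Lemma cvg_real_complex (x : T -> R) (l : R) :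
  x @ F --> l -> ((x n)%:C : C) @[n --> F] --> (l%:C : C).
Proof.
move=> xl; apply/cvgrPdist_le => _ /gt0_real_complex[e e0 ->].
move/cvgrPdist_le : xl => /(_ _ e0); apply: filterS => n.
by rewrite -rmorphB norm_real_complex lecR.
Qed.

(** The order of the complex numbers is only partial, so the bound is read on
    real parts, up to an arbitrary positive slack e that absorbs the distance
    from z to its limit. *)
Lemma norm_cvg_le (z : T -> C) (m : T -> R) (l : C) (M : R) :
  z @ F --> l -> m @ F --> M ->
  (\forall n \near F, `|z n| <= (m n)%:C) -> `|l| <= M%:C.
Proof.
move=> zl mM zm.
have lE : `|l| = (complex.Re `|l|)%:C by rewrite normc_def.
rewrite lE lecR; apply/ler_addgt0Pr => e e0.
rewrite -lerBlDr; apply: cvgr_to_ge mM _.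
have e0C : (0 : C) < e%:C by rewrite ltcR.
move/cvgrPdist_le : zl => /(_ _ e0C) zl.
near=> n.
rewrite lerBlDr -lecR -lE rmorphD /= addrC.
rewrite -(subrK (z n) l); apply: le_trans (ler_normD _ _) _.
by apply: lerD; near: n.
Unshelve. all: by end_near. Qed.

(** A limit can be taken in an approximate proportionality with relative error
    eta. It serves to replace increments by differences of one-sided limits. *)
Lemma approx_proportional_cvg (w : T -> C) (k : T -> R) (d W : C) (eta K : R) :
  w @ F --> W -> k @ F --> K ->
  (\forall n \near F, `|w n - d * (k n)%:C| <= (eta * k n)%:C) ->
  `|W - d * K%:C| <= (eta * K)%:C.
Proof.
move=> wW kK; apply: norm_cvg_le; last exact: cvgMl_tmp kK.
by apply: (cvgB wW); apply: cvgMl_tmp; exact: cvg_real_complex kK.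
Qed.

Lemma cvg_Re_Im (g : T -> C) :
  cvg ((fun x => complex.Re (g x)) @ F) ->
  cvg ((fun x => complex.Im (g x)) @ F) -> cvg (g @ F).
Proof.
move=> /cvg_real_complex cr /cvg_real_complex ci.
have -> : g = (fun x => (complex.Re (g x))%:C
                        + (('i%C : C) * (complex.Im (g x))%:C) : C).
  by apply/funext => x; rewrite -complexE.
by apply: is_cvgD; [apply: cvgP cr|apply: cvgP; apply: cvgMl_tmp; exact: ci].
Qed.

End Filter.

End ComplexLimits.

(** * One-sided limits of functions of bounded variation *)

Section OneSidedLimitsOfRealFunctions.
Context {R : realType}.
Implicit Types (f : R -> R) (a b r : R).

Lemma nondecreasing_cvg_at_right f a b r : a < r -> r < b ->
  {in `[a, b] &, nondecreasing_fun f} -> cvg (f x @[x --> r^'+]).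
Proof.
move=> ar rb ndf.
apply/cvg_ex; exists (inf (f @` [set` Interval (BRight r) (BLeft b)])).
apply: nondecreasing_at_right_cvgr; first by rewrite bnd_simp.
  apply: sub_in2 ndf => x; rewrite !in_itv /= => /andP[rx xb].
  by rewrite (ltW (lt_trans ar rx)) ltW.
exists (f a) => _ /= [x + <-]; rewrite in_itv /= => /andP[rx xb].
have ax := ltW (lt_trans ar rx).
apply: ndf; rewrite ?in_itv //= ?lexx ?ax ?(ltW xb) //.
exact/ltW/(lt_trans ar).
Qed.

Lemma nondecreasing_cvg_at_left f a b r : a < r -> r < b ->
  {in `[a, b] &, nondecreasing_fun f} -> cvg (f x @[x --> r^'-]).
Proof.
move=> ar rb ndf.
have abE x : a < x < r -> x \in `[a, b].
  by rewrite in_itv /= => /andP[/ltW -> /lt_trans/(_ rb)/ltW ->].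
apply: nondecreasing_at_left_is_cvgr; near=> x.
  move=> y z; rewrite !in_itv /= => /andP[xy yr] /andP[xz zr].
  have ax : a < x by near: x; exact: nbhs_left_gt.
  by apply: ndf; apply: abE; rewrite ?yr ?zr andbT; apply: lt_trans ax _.
exists (f r) => _ /= [y + <-]; rewrite in_itv /= => /andP[xy yr].
have ax : a < x by near: x; exact: nbhs_left_gt.
apply: ndf; [|by rewrite in_itv /= !ltW|exact: ltW].
by apply: abE; rewrite yr andbT (lt_trans ax).
Unshelve. all: by end_near. Qed.

(** Jordan decomposition, which reduces bounded variation to monotonicity. *)
Let BV_decomp f a b : bounded_variation a b f -> exists g h,
  [/\ {in `[a, b] &, nondecreasing_fun g}, {in `[a, b] &, nondecreasing_fun h}
    & {in `[a, b], f =1 g \- h}].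
Proof.
move=> bvf; exists (fine \o pos_tv a f), (fine \o neg_tv a f); split.
- exact/fine_neg_tv_nondecreasing/bounded_variationN.
- exact: fine_neg_tv_nondecreasing.
- exact: bounded_variation_pos_neg_tvE.
Qed.

Lemma bounded_variation_cvg_at_right f a b r : a < r -> r < b ->
  bounded_variation a b f -> cvg (f x @[x --> r^'+]).
Proof.
move=> ar rb /BV_decomp[g [h [ndg ndh fE]]].
have gh : cvg ((g \- h) x @[x --> r^'+]).
  by apply: is_cvgB; apply: nondecreasing_cvg_at_right ar rb _.
apply: cvgP; apply: cvg_trans gh; apply: near_eq_cvg; near=> x.
apply/esym/fE; rewrite in_itv /=; apply/andP; split; apply: ltW.
  by apply: lt_trans ar _; near: x; exact: nbhs_right_gt.
by near: x; exact: nbhs_right_lt.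
Unshelve. all: by end_near. Qed.

Lemma bounded_variation_cvg_at_left f a b r : a < r -> r < b ->
  bounded_variation a b f -> cvg (f x @[x --> r^'-]).
Proof.
move=> ar rb /BV_decomp[g [h [ndg ndh fE]]].
have gh : cvg ((g \- h) x @[x --> r^'-]).
  by apply: is_cvgB; apply: nondecreasing_cvg_at_left ar rb _.
apply: cvgP; apply: cvg_trans gh; apply: near_eq_cvg; near=> x.
apply/esym/fE; rewrite in_itv /=; apply/andP; split; apply: ltW.
  by near: x; exact: nbhs_left_gt.
by apply: lt_trans rb; near: x; exact: nbhs_left_lt.
Unshelve. all: by end_near. Qed.

End OneSidedLimitsOfRealFunctions.

Section BVComplex.
Context {R : realType}.
Local Notation C := (R[i]^o).
Variable g : R -> C.
Hypothesis bvg : locally_bounded_variation g.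

(** A coordinate p that does not increase distances inherits bounded
    variation; the real and imaginary parts are the instances of interest. *)
Lemma part_bounded_variation (p : C -> R) a b :
  (forall x y, `|p x - p y|%:C <= `|x - y|) ->
  a <= b -> bounded_variation a b (p \o g).
Proof.
move=> pg ab; have [M gM] := bvg ab.
exists M => _ [s abs <-]; rewrite -lecR; apply: le_trans (gM s abs).
by rewrite /variation rmorph_sum /complex_variation; apply: ler_sum => n _ /=.
Qed.

Lemma Re_dist (x y : C) : `|complex.Re x - complex.Re y|%:C <= `|x - y|.
Proof. by rewrite -raddfB normc_ge_Re. Qed.

Lemma Im_dist (x y : C) : `|complex.Im x - complex.Im y|%:C <= `|x - y|.
Proof.
rewrite -raddfB normc_def lecR -sqrtr_sqr ler_wsqrtr // lerDr.
exact: sqr_ge0.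
Qed.

Lemma lbv_cvg_at_left t : cvg (g x @[x --> t^'-]).
Proof.
have [a1 b1] : t - 1 < t /\ t < t + 1 by rewrite ltrBlDr ltrDl.
have ab := ltW (lt_trans a1 b1).
apply: cvg_Re_Im; apply: (bounded_variation_cvg_at_left a1 b1).
  exact: (part_bounded_variation Re_dist).
exact: (part_bounded_variation Im_dist).
Qed.

Lemma lbv_cvg_at_right t : cvg (g x @[x --> t^'+]).
Proof.
have [a1 b1] : t - 1 < t /\ t < t + 1 by rewrite ltrBlDr ltrDl.
have ab := ltW (lt_trans a1 b1).
apply: cvg_Re_Im; apply: (bounded_variation_cvg_at_right a1 b1).
  exact: (part_bounded_variation Re_dist).
exact: (part_bounded_variation Im_dist).
Qed.

End BVComplex.

(** * The forward shift *)

Section Sigma.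
Context {R : realType}.
Variable T : set R.
Hypothesis tsT : time_scale T.
Implicit Types (s t u v : R).

Local Notation above t := [set s | T s /\ t < s].

Lemma lt_ts_supP t : reflect (exists2 s, T s & t < s) (t%:E < ts_sup T)%E.
Proof.
apply: (iffP idP) => [/ereal_sup_gt[_ [s Ts <-]]|[s Ts ts]].
  by rewrite lte_fin; exists s.
apply: (@lt_le_trans _ _ s%:E); first by rewrite lte_fin.
by apply: ereal_sup_ubound; exists s.
Qed.

Let above_lbound t : has_lbound (above t).
Proof. by exists t => s [_ /ltW]. Qed.

Let sigmaE_lt t s : T s -> t < s -> sigma T t = inf (above t).
Proof.
by move=> Ts ts; rewrite /sigma ifT //; apply/lt_ts_supP; exists s.
Qed.

Let sigmaE_ge t : (forall s, T s -> s <= t) -> sigma T t = sup T.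
Proof.
move=> Tt; rewrite /sigma ifF; last first.
  by apply/negP => /lt_ts_supP[s /Tt st]; rewrite ltNge st.
by rewrite /ts_sup ereal_sup_EFin //; [exists t|case: tsT].
Qed.

Let sigma_cases t : (exists2 s, T s & t < s) \/ (forall s, T s -> s <= t).
Proof.
have [?|no] := pselect (exists2 s, T s & t < s); [by left|right=> s Ts].
by rewrite leNgt; apply/negP => ts; apply: no; exists s.
Qed.

Lemma sigma_le t s : T s -> t < s -> sigma T t <= s.
Proof. by move=> Ts ts; rewrite (sigmaE_lt Ts ts); apply: ge_inf. Qed.

(** The minimum accounts for the two branches of sigma: below sup T one has
    t <= sigma t, and from sup T on sigma t bounds every point s of T. *)
Lemma le_sigma t s : T s -> Num.min t s <= sigma T t.
Proof.
move=> Ts; have [[r Tr tr]|Tt] := sigma_cases t.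
  rewrite (sigmaE_lt Tr tr) ge_min; apply/orP; left.
  by apply: lb_le_inf; [exists r|move=> ? [_ /ltW]].
rewrite (sigmaE_ge Tt) ge_min; apply/orP; right.
by apply: ub_le_sup => //; exists t.
Qed.

(** Without a point of T after t, the shift would be sup T and might lie below
    v with nothing of T in between. *)
Lemma sigma_lt t v : sigma T t < v -> (exists2 s, T s & t < s) ->
  exists2 s, T s & t < s < v.
Proof.
move=> tv [r Tr tr]; move: tv; rewrite (sigmaE_lt Tr tr) => tv.
have lt0 : 0 < v - inf (above t) by rewrite subr_gt0.
have [|s [Ts ts]] := inf_adherent lt0 (conj _ (above_lbound t)).
  by exists r.
by rewrite addrC subrK => sv; exists s; rewrite ?ts.
Qed.

Lemma sigma_in t : T (sigma T t).
Proof.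
have [T0 /closure_id TE] := tsT.
suff : closure T (sigma T t) by rewrite -TE.
have [[r Tr tr]|Tt] := sigma_cases t; last first.
  by rewrite (sigmaE_ge Tt); apply: closure_sup => //; exists t.
move=> U /nbhs_ballP[e /= e0 eU].
have [|s [Ts ts] se] := inf_adherent e0 (conj _ (above_lbound t)).
  by exists r.
exists s; split=> //; apply: eU.
rewrite (sigmaE_lt Tr tr) /ball /= distrC ger0_norm ?ltrBlDl //.
by rewrite subr_ge0 ge_inf.
Qed.

Lemma sigma_homo : nondecreasing_fun (sigma T).
Proof.
move=> u v uv; have := le_sigma v (sigma_in u).
have [/(sigma_le (sigma_in v))//|vu] := ltP u (sigma T v).
rewrite ge_min => /orP[vv|//].
by have -> : u = v by apply/le_anti; rewrite uv (le_trans vv).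
Qed.

Lemma sigma_right_continuous t v : sigma T t < v ->
  \forall u \near t^'+, sigma T u < v.
Proof.
move=> tv; have [ex|Tt] := sigma_cases t; last first.
  near=> u; rewrite sigmaE_ge -?(sigmaE_ge Tt) // => s /Tt st.
  by apply: le_trans st _; near: u; exact: nbhs_right_ge.
have [s Ts /andP[ts sv]] := sigma_lt tv ex.
by near=> u; apply: le_lt_trans sv; exact: sigma_le.
Unshelve. all: by end_near. Qed.

(** The first point of T at or after t, or sup T past the end of T. *)
Definition tau t := if t \in T then t else sigma T t.

Lemma tau_in t : T (tau t).
Proof. by rewrite /tau; case: ifPn => [/set_mem//|_]; exact: sigma_in. Qed.

Lemma tau_le_sigma t : tau t <= sigma T t.
Proof.
rewrite /tau; case: ifPn => // /set_mem Tt.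
by have := le_sigma t Tt; rewrite minxx.
Qed.

Lemma sigma_le_tau u v : u < v -> sigma T u <= tau v.
Proof.
move=> uv; rewrite /tau; case: ifPn => [/set_mem Tv|_]; first exact: sigma_le.
exact/sigma_homo/ltW.
Qed.

Lemma ts_extensionE (f : R -> R[i]^o) t : ts_extension T f t = f (tau t).
Proof. by rewrite /ts_extension /tau; case: ifP. Qed.

Lemma kappa_sub : ts_kappa T `<=` T.
Proof.
have [_ /closure_id TE] := tsT; rewrite {2}TE.
by apply: closureS => t [].
Qed.

(** If t is not the maximum of T, then sigma is at most t before t and exceeds
    t after it. If it is, then t is left dense, being in T^kappa, and a point
    of T strictly between u and t separates the two values. *)
Lemma sigma_kappa_lt t u v : ts_kappa T t -> u < t -> t < v ->
  sigma T u < sigma T v.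
Proof.
move=> kt ut tv; have Tt := kappa_sub kt.
have [[s Ts ts]|maxt] := sigma_cases t.
  apply: le_lt_trans (sigma_le Tt ut) _.
  by apply: lt_le_trans (le_sigma v Ts); rewrite lt_min tv.
have supt : ts_sup T = t%:E.
  apply/le_anti/andP; split.
    by apply: ge_ereal_sup => _ [s Ts <-]; rewrite lee_fin maxt.
  by apply: ereal_sup_ubound; exists t.
have tu0 : 0 < t - u by rewrite subr_gt0.
have [s [[Ts /= sN] /=]] := kt _ (nbhsx_ballx t _ tu0).
rewrite /ball /= => tsu.
have st : s < t.
  rewrite lt_neqAle maxt // andbT; apply/eqP => st; apply: sN.
  by rewrite supt st.
have us : u < s by move: tsu; rewrite gtr0_norm ?subr_gt0 // ltrD2l ltrN2.
apply: le_lt_trans (sigma_le Ts us) _; apply: lt_le_trans st _.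
by have := le_sigma v Tt; rewrite (min_idPr (ltW tv)).
Qed.

Lemma tau_between u t : T t -> u < t -> u <= tau u <= t.
Proof.
move=> Tt ut; rewrite (le_trans (tau_le_sigma u) (sigma_le Tt ut)) andbT.
rewrite /tau; case: ifP => // _.
by have := le_sigma u Tt; rewrite (min_idPl (ltW ut)).
Qed.

(** A property of the points of T near t that also holds at sigma t is carried
    by tau to all reals near t: right of a right-scattered t the value tau u
    is sigma t, and in all other cases tau u is a point of T near t. *)
Lemma near_tau_trans t (P : R -> Prop) : T t -> P (sigma T t) ->
  (\forall s \near within T (nbhs t), P s) ->
  \forall u \near t, P (tau u).
Proof.
move=> Tt Ps.
rewrite /= near_withinE => /nbhs_ballP[e /= e0 eP].
have te : \forall u \near t^'+, P (tau u).
  have [tt|st] := ltP t (sigma T t).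
    near=> u.
    suff -> : tau u = sigma T t by [].
    apply/le_anti; rewrite sigma_le_tau ?andbT; last first.
      by near: u; exact: nbhs_right_gt.
    apply: le_trans (tau_le_sigma u) _; apply: sigma_le; first exact: sigma_in.
    by near: u; exact: nbhs_right_lt.
  have tte : sigma T t < t + e by rewrite (le_lt_trans st) // ltrDl.
  near=> u; apply: eP; last exact: tau_in.
  have tu : t < u by near: u; exact: nbhs_right_gt.
  have ttu : t <= tau u.
    apply: le_trans (sigma_le_tau tu).
    by have := le_sigma t Tt; rewrite minxx.
  rewrite /ball /= distrC ger0_norm ?subr_ge0 // ltrBlDl.
  apply: le_lt_trans (tau_le_sigma u) _.
  by near: u; apply: sigma_right_continuous.
move: te; rewrite near_withinE; apply: filterS2 (nbhsx_ballx t _ e0) => u.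
rewrite /ball /= => ute tuP; have [ut|/tuP//|->] := ltgtP u t; last first.
  by rewrite /tau mem_set //; apply: eP => //; exact: ballxx.
have /andP[uu tt] := tau_between Tt ut.
apply: eP; last exact: tau_in.
rewrite /ball /= ger0_norm ?subr_ge0 //; apply: le_lt_trans ute.
by rewrite [leRHS]gtr0_norm ?subr_gt0 // lerD2l lerN2.
Unshelve. all: by end_near. Qed.

End Sigma.

(** * Interlaced functions have the same one-sided limits *)

Section Interlaced.
Context {R : realType}.
Variables f h : R -> R.
Hypothesis hf : forall x, h x <= f x.
Hypothesis fh : forall x y, x < y -> f x <= h y.

(** To the left of b, a value f u close to the limit bounds h from below on all
    of ]u, b[. *)
Lemma interlaced_cvg_at_left b : cvg (f x @[x --> b^'-]) ->
  h x @[x --> b^'-] --> left_lim f b.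
Proof.
move=> /= fb; apply/cvgrPdist_le => e e0.
move/cvgrPdist_le : fb => /(_ e e0) fb.
have [u [ub fu]] : exists u, u < b /\ `|left_lim f b - f u| <= e.
  near (b^'-) => u; exists u; split; first by near: u; exact: nbhs_left_lt.
  by near: u.
near=> x.
have ux : u < x by near: x; exact: nbhs_left_gt.
have fx : `|left_lim f b - f x| <= e by near: x.
have := hf x; have := fh ux.
move: fu fx; rewrite !ler_norml; lra.
Unshelve. all: by end_near. Qed.

Lemma interlaced_cvg_at_right a : cvg (f x @[x --> a^'+]) ->
  h x @[x --> a^'+] --> right_lim f a.
Proof.
move=> fa.
apply: (@squeeze_cvgr _ _ _ _ (cst (right_lim f a)) f _ _ _ (cvg_cst _) fa).
near=> x; rewrite hf andbT; apply: limr_le => //; near=> y.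
by apply: fh; near: y; apply: nbhs_right_lt; near: x; exact: nbhs_right_gt.
Unshelve. all: by end_near. Qed.

End Interlaced.

(** * Comparison of the increments *)

Section Increments.
Context {R : realType}.
Local Notation C := (R[i]^o).
Variable T : set R.
Hypothesis tsT : time_scale T.

Let sigma_nd a b : {in `[a, b] &, nondecreasing_fun (sigma T)}.
Proof. by move=> x y _ _; exact: sigma_homo. Qed.

Lemma sigma_cvg_at_left t : cvg (sigma T x @[x --> t^'-]).
Proof.
by apply: (@nondecreasing_cvg_at_left _ _ (t - 1) (t + 1)) => //;
  rewrite ?ltrBlDr ltrDl.
Qed.

Lemma sigma_cvg_at_right t : cvg (sigma T x @[x --> t^'+]).
Proof.
by apply: (@nondecreasing_cvg_at_right _ _ (t - 1) (t + 1)) => //;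
  rewrite ?ltrBlDr ltrDl.
Qed.

Lemma sigma_oo_gt0 t e : ts_kappa T t -> 0 < e ->
  0 < stieltjes_oo (sigma T) (t - e) (t + e).
Proof.
move=> kt e0; rewrite subr_gt0.
have e20 : 0 < e / 2 by rewrite divr_gt0.
apply: (@le_lt_trans _ _ (sigma T (t - e / 2))).
  apply: limr_le; first exact: sigma_cvg_at_right.
  near=> x; apply/sigma_homo => //.
  near: x; apply: nbhs_right_le; lra.
apply: (@lt_le_trans _ _ (sigma T (t + e / 2))).
  apply: (sigma_kappa_lt tsT kt); lra.
apply: limr_ge; first exact: sigma_cvg_at_left.
near=> x; apply/sigma_homo => //.
near: x; apply: nbhs_left_ge; lra.
Unshelve. all: by end_near. Qed.

(** The two Hilger inequalities are based at the same point sigma t, and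
    tau u <= sigma t <= tau v makes their error terms add up to the increment
    of tau. *)
Lemma extension_increment_bound (f : R -> C) (d : C) (t eta : R) : T t ->
  is_delta_derivative T f t d -> 0 < eta ->
  \forall e \near 0^'+, forall u v, t - e < u -> u < t -> t < v -> v < t + e ->
    `|(ts_extension T f v - ts_extension T f u) - d * (tau T v - tau T u)%:C|
      <= (eta * (tau T v - tau T u))%:C.
Proof.
move=> Tt fd eta0.
(* At s = sigma T t both sides of the Hilger inequality vanish. *)
have := near_tau_trans tsT Tt _ (fd eta eta0).
rewrite !subrr normr0 rmorph0 !mulr0 subr0 normr0 lexx => /(_ isT).
move=> /nbhs_ballP[e0 /= e00 e0P].
near=> e => u v eu ut tv ve.
have ee0 : e < e0 by near: e; exact: nbhs_right_lt.
have tt : t <= sigma T t by have := le_sigma tsT t Tt; rewrite minxx.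
have ttv : sigma T t <= tau T v by exact: sigma_le_tau.
have tut : tau T u <= sigma T t.
  by apply: le_trans tt; have /andP[] := tau_between tsT Tt ut.
have bu : ball t e0 u by rewrite /ball /= gtr0_norm; lra.
have bv : ball t e0 v by rewrite /ball /= ltr0_norm; lra.
have := e0P _ bu; have := e0P _ bv.
rewrite -!ts_extensionE.
rewrite (ger0_norm (_ : 0 <= sigma T t - tau T u)) ?subr_ge0 //.
rewrite (ler0_norm (_ : sigma T t - tau T v <= 0)) ?subr_le0 //.
set F := ts_extension T f; set s := sigma T t => Hv Hu.
have -> : (F v - F u) - d * (tau T v - tau T u)%:C =
  (f s - F u - d * (s - tau T u)%:C) - (f s - F v - d * (s - tau T v)%:C).
  by rewrite !rmorphB /=; ring.
apply: le_trans (ler_normB _ _) _.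
apply: le_trans (lerD Hu Hv) _.
rewrite -rmorphD lecR; lra.
Unshelve. all: by end_near. Qed.

End Increments.

(** * Coincidence of the two derivatives *)

Theorem theorem2p2 (R : realType) (T : set R) (f fDelta : R -> R[i]^o) :
  time_scale T ->
  (forall t, ts_kappa T t -> is_delta_derivative T f t (fDelta t)) ->
  locally_bounded_variation (ts_extension T f) ->
  forall t, ts_kappa T t ->
    is_RN_derivative (ts_extension T f) (sigma T) t (fDelta t).
Proof.
move=> tsT fD bvf t kt; have Tt := kappa_sub tsT kt.
have S0 e : 0 < e -> 0 < stieltjes_oo (sigma T) (t - e) (t + e).
  exact: sigma_oo_gt0.
split.
  by near=> e; rewrite gt_eqF // S0 //; near: e; exact: nbhs_right_gt.
set F := ts_extension T f; set d := fDelta t.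
apply/cvgrPdist_le => _ /gt0_real_complex[eta eta0 ->].
have fin := extension_increment_bound tsT Tt (fD t kt) eta0.
near=> e.
have e0 : 0 < e by near: e; exact: nbhs_right_gt.
have uv_bound : forall u v, t - e < u -> u < t -> t < v -> v < t + e ->
    `|(F v - F u) - d * (tau T v - tau T u)%:C|
      <= (eta * (tau T v - tau T u))%:C by near: e; exact: fin.
have tauL : tau T x @[x --> (t + e)^'-] --> left_lim (sigma T) (t + e).
  apply: interlaced_cvg_at_left; last exact: sigma_cvg_at_left.
    exact: tau_le_sigma.
  exact: sigma_le_tau.
have tauR : tau T x @[x --> (t - e)^'+] --> right_lim (sigma T) (t - e).
  apply: interlaced_cvg_at_right; last exact: sigma_cvg_at_right.
    exact: tau_le_sigma.
  exact: sigma_le_tau.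
have FL : F x @[x --> (t + e)^'-] --> left_lim F (t + e).
  exact: lbv_cvg_at_left.
have FR : F x @[x --> (t - e)^'+] --> right_lim F (t - e).
  exact: lbv_cvg_at_right.
have u_bound : forall u, t - e < u -> u < t ->
    `|(left_lim F (t + e) - F u)
        - d * (left_lim (sigma T) (t + e) - tau T u)%:C|
      <= (eta * (left_lim (sigma T) (t + e) - tau T u))%:C.
  move=> u eu ut.
  apply: (approx_proportional_cvg (F := (t + e)^'-)
    (cvgB FL (cvg_cst (F u))) (cvgB tauL (cvg_cst (tau T u)))).
  near=> v; apply: uv_bound => //.
  by near: v; apply: nbhs_left_gt; rewrite ltrDl.
have bound : `|stieltjes_oo F (t - e) (t + e) -
      d * (stieltjes_oo (sigma T) (t - e) (t + e))%:C|
      <= (eta * stieltjes_oo (sigma T) (t - e) (t + e))%:C.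
  apply: (approx_proportional_cvg (F := (t - e)^'+)
    (cvgB (cvg_cst (left_lim F (t + e))) FR)
    (cvgB (cvg_cst (left_lim (sigma T) (t + e))) tauR)).
  near=> v; apply: u_bound => //.
  by near: v; apply: nbhs_right_lt; rewrite ltrBlDr ltrDl.
move: bound (S0 e e0); set S := stieltjes_oo (sigma T) _ _ => bound Sgt0.
have SC0 : (0 : R[i]) < S%:C by rewrite ltcR.
rewrite distrC -(mulfK (lt0r_neq0 SC0) d) -mulrBl normrM normfV.
by rewrite (gtr0_norm SC0) ler_pdivrMr // -rmorphM.
Unshelve. all: by end_near. Qed.
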